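(* Let $p=\{p_n\}$ be a discrete probability distribution. For every $\alpha\in[2,\infty]$, the Rényi $\alpha$-entropy of $p$ satisfies $$R_{\alpha}(p)\;\geq\;\frac{1}{\alpha-1}\,R_{2}(p)+\frac{\alpha-2}{\alpha-1}\,R_{\infty}(p),$$ where for $\alpha=\infty$ the coefficients are understood as their limits, $\frac{1}{\alpha-1}=0$ and $\frac{\alpha-2}{\alpha-1}=1$.
   Context: A discrete probability distribution is a finite or countable family of numbers $p_n\ge 0$ with $\sum_n p_n=1$. For $\alpha>0$, $\alpha\neq 1$, $\alpha<\infty$, the Rényi $\alpha$-entropy is $R_{\alpha}(p)=\frac{1}{1-\alpha}\ln\left(\sum_n p_n^{\alpha}\right)$. In particular $R_2(p)=-\ln\left(\sum_n p_n^2\right)$ (collision entropy). For $\alpha=\infty$ one sets $R_{\infty}(p)=-\ln(\max_n p_n)$ (min-entropy). *)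

(* Defs.v *)
From HB Require Import structures.
From mathcomp Require Import all_boot all_order all_algebra.
From mathcomp Require Import all_classical all_reals all_analysis.
Set Implicit Arguments.
Unset Strict Implicit.
Unset Printing Implicit Defensive.
Import Order.TTheory GRing.Theory Num.Theory.
Local Open Scope classical_set_scope.
Local Open Scope ring_scope.

(* A countType is a type with an injection into nat, so T covers finite and
   countably infinite index sets alike. *)
Definition prob_distr (R : realType) (T : countType) (p : T -> R) : Prop :=
  (forall n, 0 <= p n) /\ (\esum_(n in [set: T]) (p n)%:E = 1)%E.

(* Intended for finite alpha > 0, alpha != 1.  The value is in \bar R because
   the sum of the p_n ^ alpha may diverge when alpha < 1. *)
Definition renyi_fin (R : realType) (T : countType) (alpha : R) (p : T -> R)
    : \bar R :=
  ((1 - alpha)^-1%:E * lne (\esum_(n in [set: T]) (p n `^ alpha)%:E))%E.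

(* The maximum is rendered as a supremum; sup_prob_distr below shows that it
   is attained. *)
Definition min_entropy (R : realType) (T : countType) (p : T -> R) : \bar R :=
  (- ln (sup (range p)))%:E.

(* The value at alpha = -oo is a placeholder. *)
Definition renyi (R : realType) (T : countType) (alpha : \bar R) (p : T -> R)
    : \bar R :=
  match alpha with
  | a%:E => renyi_fin a p
  | +oo => min_entropy p
  | -oo => 0
  end%E.

(* 1 / (alpha - 1), with its limit at +oo; the value at -oo is a placeholder. *)
Definition coef2 (R : realType) (alpha : \bar R) : R :=
  match alpha with
  | a%:E%E => 1 / (a - 1)
  | +oo%E => 0
  | -oo%E => 0
  end.

(* (alpha - 2) / (alpha - 1), with its limit at +oo; the value at -oo is a
   placeholder. *)
Definition coefoo (R : realType) (alpha : \bar R) : R :=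
  match alpha with
  | a%:E%E => (a - 2) / (a - 1)
  | +oo%E => 1
  | -oo%E => 0
  end.

Lemma prob_distr_sum_le1 (R : realType) (T : countType) (p : T -> R)
    (hp : prob_distr p) (s : seq T) (us : uniq s) : \sum_(n <- s) p n <= 1.
Proof.
case: hp => p0 p1; rewrite -lee_fin -p1.
apply: ereal_sup_ubound; exists [set` s].
  by split; [exact: finite_seq | exact: subsetT].
by rewrite -fsbig_seq //= sumEFin.
Qed.

Lemma sup_prob_distr (R : realType) (T : countType) (p : T -> R)
    (hp : prob_distr p) :
  exists n0, (forall n, p n <= p n0) /\ sup (range p) = p n0.
Proof.
have [p0 p1] := hp.
have [n1 n1_gt0] : exists n, 0 < p n.
  apply: contrapT => /forallNP pN.
  have p00 n : p n = 0.
    apply/eqP; rewrite eq_le p0 andbT leNgt; exact/negP/pN.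
  suff : (\esum_(n in [set: T]) (p n)%:E = 0)%E.
    by rewrite p1 => /eqP; rewrite onee_eq0.
  by apply: esum1 => n _; rewrite p00.
suff [n0 hn0] : exists n0, forall n, p n <= p n0.
  exists n0; split => //; apply/eqP; rewrite eq_le; apply/andP; split.
    by apply: ge_sup => [|_ [n _ <-]//]; exists (p n0), n0.
  apply: ub_le_sup; last by exists n0.
  by exists (p n0) => _ [n _ <-].
have /finite_seqP[s sE] : finite_set [set n | p n1 <= p n].
  apply: contrapT => /(infinite_set_fset (Num.bound (p n1)^-1)).
  case=> A As cA.
  have := prob_distr_sum_le1 hp (finmap.fset_uniq A); apply/negP; rewrite -ltNge.
  apply: (@lt_le_trans _ _ (\sum_(n <- finmap.enum_fset A) p n1)); last first.
    rewrite big_seq [leRHS]big_seq; apply: ler_sum => n nA; exact: (As n).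
  rewrite big_const_seq count_predT iter_addr_0 -mulr_natl -ltr_pdivrMr //.
  rewrite mul1r; apply: (@lt_le_trans _ _ (Num.bound (p n1)^-1)%:R).
    by apply: archi_boundP; rewrite invr_ge0.
  by rewrite ler_nat.
have [n0 n0s hn0] : exists2 n0, n0 \in n1 :: s &
    forall n, n \in n1 :: s -> p n <= p n0.
  elim: s n1 {n1_gt0 sE} => [|m s ih] n1.
    by exists n1; rewrite ?mem_head // => n; rewrite inE => /eqP->.
  have [k ks hk] := ih m; have [le|lt] := leP (p n1) (p k).
    exists k; first by rewrite inE ks orbT.
    by move=> n; rewrite inE => /predU1P[->//|/hk].
  exists n1; first by rewrite mem_head.
  move=> n; rewrite inE => /predU1P[->//|/hk h]; exact: le_trans h (ltW lt).
exists n0 => n; have [le|lt] := leP (p n1) (p n).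
  apply: hn0; rewrite inE; apply/orP; right.
  have : [set n | p n1 <= p n] n by [].
  by rewrite sE.
by apply: le_trans (ltW lt) _; apply: hn0; rewrite mem_head.
Qed.

(* Main.v *)
(* Writing M for the largest probability, p_n ^ a <= M ^ (a - 2) * p_n ^ 2 for
   a >= 2; sum over n, take logarithms and divide by 1 - a < 0. *)
Require Import Defs.
From HB Require Import structures.
From mathcomp Require Import all_boot all_order all_algebra.
From mathcomp Require Import all_classical all_reals all_analysis.
From mathcomp Require Import ring lra.
Import Order.TTheory GRing.Theory Num.Theory.
Local Open Scope ring_scope.

(** Let M be the largest probability, attained by [sup_prob_distr]. For finite a >= 2, monotonicity
    of x^(a-2) gives p_n^a = p_n^(a-2) p_n^2 <= M^(a-2) p_n^2. Summing, with [ge0_esumZl_le] to pull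
    out M^(a-2), and taking logarithms bounds ln(sum p_n^a) by (a-2) ln M + ln(sum p_n^2); dividing
    by 1-a < 0 reverses this into the claim. By [esum_powR_gt0_fin] both sums are positive reals, so
    the argument takes place in [R]. *)

Lemma ge0_esumZl_le (R : realType) (T : choiceType) (I : set T)
    (a : T -> \bar R) (c : R) :
  0 <= c -> (forall i, 0 <= a i)%E ->
  (\esum_(i in I) (c%:E * a i) <= c%:E * \esum_(i in I) a i)%E.
Proof.
move=> c0 a0; apply: ge_ereal_sup => _ [X IX <-].
rewrite -ge0_mule_fsumr//; apply: lee_wpmul2l; first by rewrite lee_fin.
by apply: ereal_sup_ubound; exists X.
Qed.

Lemma prob_distr_exists_gt0 (R : realType) (T : countType) (p : T -> R) :
  prob_distr p -> exists n, 0 < p n.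
Proof.
move=> [p0 p1]; apply: contrapT => /forallNP pN.
suff : (\esum_(n in [set: T]) (p n)%:E = 0)%E.
  by rewrite p1 => /eqP; rewrite onee_eq0.
apply: esum1 => n _; congr EFin; apply/eqP.
by rewrite eq_le p0 andbT leNgt; exact/negP.
Qed.

(** On [0,1] one has x^a <= x for a >= 1, so the sum is at most 1; a single positive probability
    keeps it above 0. *)
Lemma esum_powR_gt0_fin (R : realType) (T : countType) (p : T -> R) (a : R) :
  prob_distr p -> 1 <= a ->
  exists2 s : R, 0 < s & (\esum_(n in [set: T]) (p n `^ a)%:E = s%:E)%E.
Proof.
move=> hp a1; have [p0 p1] := hp.
have p_le1 n : p n <= 1.
  have := @prob_distr_sum_le1 _ _ _ hp [:: n] isT.
  by rewrite big_seq1.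
have le1 : (\esum_(n in [set: T]) (p n `^ a)%:E <= 1)%E.
  rewrite -p1; apply: le_esum => n _; rewrite lee_fin.
  have [->|pn0] := eqVneq (p n) 0.
    by rewrite powR0//; lra.
  by rewrite ge1r_powR// p_le1 lt_neqAle eq_sym pn0 p0.
have gt0 : (0 < \esum_(n in [set: T]) (p n `^ a)%:E)%E.
  have [n pn0] := @prob_distr_exists_gt0 _ _ _ hp.
  apply: (@lt_le_trans _ _ (p n `^ a)%:E); first by rewrite lte_fin powR_gt0.
  apply: esum_ge; exists [set n]%classic; first by split.
  by rewrite fsbig_set1.
by case: esum gt0 le1 => [s s0 _| |] //; exists s.
Qed.

Theorem proposition1 (R : realType) (T : countType) (p : T -> R)
    (hp : prob_distr p) (alpha : \bar R) (halpha : (2%:E <= alpha)%E) :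
  ((coef2 alpha)%:E * renyi 2%:E p + (coefoo alpha)%:E * renyi +oo p
     <= renyi alpha p)%E.
Proof.
(* At [+oo] the coefficients 0 and 1 reduce both sides to the min-entropy. *)
case: alpha halpha => [a| |] //; last by rewrite /= mul0e add0e mul1e.
rewrite lee_fin /= => a2.
have [p0 _] := hp; have [n0 [n0_max sup_p]] := sup_prob_distr hp.
have M0 : 0 < p n0.
  have [n pn0] := @prob_distr_exists_gt0 _ _ _ hp.
  exact: lt_le_trans (n0_max n).
have [s s0 sE] : exists2 s, 0 < s & _ :=
  @esum_powR_gt0_fin _ _ _ a hp ltac:(lra).
have [t t0 tE] : exists2 t, 0 < t & _ :=
  @esum_powR_gt0_fin _ _ _ 2 hp ltac:(lra).
rewrite /min_entropy sup_p /renyi_fin sE tE !lne_EFin// -!EFinM -EFinD lee_fin.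
have st : s <= p n0 `^ (a - 2) * t.
  rewrite -lee_fin EFinM -sE -tE.
  apply: le_trans (@ge0_esumZl_le _ _ _ _ _ (powR_ge0 _ _) _); last first.
    by move=> n; rewrite lee_fin powR_ge0.
  (* Termwise comparison with a split as (a - 2) + 2; a zero probability is treated apart, since the
     exponent law is applied to a nonzero base. *)
  apply: le_esum => n _; rewrite -EFinM lee_fin -[in leLHS](subrK 2 a).
  have [->|pn0] := eqVneq (p n) 0.
    by rewrite powR0 ?mulr_ge0 ?powR_ge0//; lra.
  rewrite (@powRD _ (p n)) ?pn0 ?implybT// ler_wpM2r ?powR_ge0//.
  by rewrite ge0_ler_powR ?nnegrE ?p0 ?n0_max//; lra.
have : ln s <= (a - 2) * ln (p n0) + ln t.
  rewrite -ln_powR -lnM ?posrE ?powR_gt0// ler_ln ?posrE//.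
  by rewrite mulr_gt0// powR_gt0.
have a1 : a - 1 != 0 by apply/eqP; lra.
(* Both sides are put over the positive denominator a - 1, which leaves the negated logarithmic
   inequality. *)
have -> : (1 - a)^-1 * ln s = - ln s / (a - 1).
  by rewrite -(opprB a 1) invrN mulNr mulrC mulNr.
have -> : 1 / (a - 1) * ((1 - 2)^-1 * ln t) + (a - 2) / (a - 1) * - ln (p n0)
    = - ((a - 2) * ln (p n0) + ln t) / (a - 1).
  have -> : (1 - 2 : R) = -1 by lra.
  by rewrite invrN1; field.
by move=> h; rewrite ler_pM2r ?invr_gt0 ?lerN2//; lra.
Qed.
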